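(* Let $T=(V,E)$ be a tree on $n \ge 3$ vertices with $\ell$ leaves. The following are equivalent: (i) $\operatorname{fd}(T) < n - \ell$; (ii) for every FD-set $D$ of $T$ with $|D| = \operatorname{fd}(T)$, there are two adjacent vertices in $V \setminus D$; (iii) $T$ contains a special corona-subtree.
   Context: All graphs are finite and simple; $N(v)$ denotes the open neighborhood of $v$. For a graph $G=(V,E)$ and an integer $k \ge 1$, a $k$-fair dominating set is a dominating set $D \subseteq V$ such that $|N(v) \cap D| = k$ for every $v \in V \setminus D$ (the set $D = V$ qualifies vacuously). A fair dominating set (FD-set) is a set that is a $k$-fair dominating set for some $k \ge 1$. If $G$ has at least one edge, $\operatorname{fd}(G)$ is the minimum cardinality of an FD-set of $G$. A leaf is a vertex of degree one and a support vertex is a neighbor of a leaf; for a tree $H$, $S_H$ denotes its set of support vertices. The corona of a graph $H'$ is the graph obtained from $H'$ by attaching a new leaf to each vertex of $H'$. A subtree $H$ of a tree $T$ is a special corona-subtree of $T$ if $H$ is the corona of a tree, $H \neq T$, and $N(x) \cap S_H = \emptyset$ for every vertex $x \in V(T) \setminus V(H)$ (neighborhoods taken in $T$). *)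

(* Defs.v *)
From mathcomp Require Import all_boot.

Set Implicit Arguments.
Unset Strict Implicit.
Unset Printing Implicit Defensive.

Record sgraph := SGraph {
  vertex :> finType;
  adj : rel vertex;
  adj_sym : symmetric adj;
  adj_irr : irreflexive adj
}.

Definition nbr (G : sgraph) (v : G) : {set G} := [set u | adj v u].

Definition is_tree (G : sgraph) : Prop :=
  [/\ 0 < #|G|,
      (forall x y : G, connect (@adj G) x y) &
      (forall c : seq G, 2 < size c -> ~ ucycle (@adj G) c)].

Definition leaves (G : sgraph) : {set G} := [set v | #|nbr v| == 1].

(* Both vertices of K_2 are leaves, hence both are support vertices. *)
Definition supports (G : sgraph) : {set G} :=
  [set v | [exists u in leaves G, adj v u]].

Definition dominating (G : sgraph) (D : {set G}) : bool :=
  [forall v in ~: D, nbr v :&: D != set0].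

Definition fair_dominating (G : sgraph) (k : nat) (D : {set G}) : bool :=
  dominating D && [forall v in ~: D, #|nbr v :&: D| == k].

Definition FD_set (G : sgraph) (D : {set G}) : Prop :=
  exists2 k, 0 < k & fair_dominating k D.

(* A witness k never needs to exceed the order of the graph, except that D = V
   has the witness 1 even when there is no vertex at all. *)
Definition FD_setb (G : sgraph) (D : {set G}) : bool :=
  [exists k : 'I_#|G|.+2, (0 < k) && fair_dominating k D].

Lemma FD_setP (G : sgraph) (D : {set G}) : reflect (FD_set D) (FD_setb D).
Proof.
apply: (iffP existsP) => [[k /andP[k0 kD]]|[k k0 kD]]; first by exists k.
have [->|/eqP DT] := eqVneq D setT.
  exists (Ordinal (isT : 1 < #|G|.+2)); rewrite /fair_dominating /dominating /=.
  by apply/andP; split; apply/forall_inP => v; rewrite !inE.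
have [v vD] : exists v, v \in ~: D.
  by apply/set0Pn/eqP => D0; apply: DT; rewrite -[D]setCK D0 setC0.
have kG : k < #|G|.+2.
  case/andP: kD => _ /forall_inP/(_ v vD)/eqP <-.
  by rewrite ltnS (leq_trans (max_card _)).
by exists (Ordinal kG); rewrite /= k0.
Qed.

Lemma FD_setT (G : sgraph) : FD_set [set: G].
Proof.
exists 1 => //; rewrite /fair_dominating /dominating.
by apply/andP; split; apply/forall_inP => v; rewrite !inE.
Qed.

Definition fd (G : sgraph) : nat :=
  #|[arg min_(D < [set: G] | FD_setb D) #|D|]|.

Lemma fdP (G : sgraph) :
  (exists2 D : {set G}, FD_set D & #|D| = fd G) /\
  (forall D : {set G}, FD_set D -> fd G <= #|D|).
Proof.
rewrite /fd; case: arg_minnP => [|D /FD_setP FD minD]; first exact/FD_setP/FD_setT.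
by split=> [|A /FD_setP /minD //]; exists D.
Qed.

(* The left copy of H is H itself, and inr x is the new leaf at inl x. *)
Definition corona_adj (H : sgraph) : rel (H + H) := fun a b =>
  match a, b with
  | inl x, inl y => adj x y
  | inl x, inr y | inr x, inl y => x == y
  | inr _, inr _ => false
  end.

Lemma corona_sym (H : sgraph) : symmetric (@corona_adj H).
Proof. by move=> [x|x] [y|y] /=; rewrite ?(eq_sym y) ?(adj_sym y). Qed.

Lemma corona_irr (H : sgraph) : irreflexive (@corona_adj H).
Proof. by move=> [x|x] //=; exact: adj_irr. Qed.

Definition corona (H : sgraph) : sgraph :=
  SGraph (@corona_sym H) (@corona_irr H).

Definition isomorphic (G H : sgraph) : Prop :=
  exists2 f : G -> H, bijective f & forall x y, adj (f x) (f y) = adj x y.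

Record subgraph (G : sgraph) := Subgraph {
  sub_vset : {set G};
  sub_adj : rel G;
  sub_adj_sym : symmetric sub_adj;
  sub_adj_sub : subrel sub_adj (@adj G);
  sub_adj_vset : forall x y, sub_adj x y -> x \in sub_vset
}.

Section GraphOfSubgraph.
Variables (G : sgraph) (H : subgraph G).

Definition sub_rel : rel {x : G | x \in sub_vset H} :=
  fun x y => sub_adj H (val x) (val y).

Lemma sub_rel_sym : symmetric sub_rel.
Proof. by move=> x y; exact: sub_adj_sym. Qed.

Lemma sub_rel_irr : irreflexive sub_rel.
Proof. by move=> x; apply/negP => /sub_adj_sub; rewrite adj_irr. Qed.

Definition graph_of : sgraph := SGraph sub_rel_sym sub_rel_irr.

End GraphOfSubgraph.

Coercion graph_of : subgraph >-> sgraph.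

Definition is_whole (G : sgraph) (H : subgraph G) : Prop :=
  sub_vset H = [set: G] /\ sub_adj H =2 @adj G.

Definition sub_supports (G : sgraph) (H : subgraph G) : {set G} :=
  [set val x | x in supports H].

Definition special_corona_subtree (T : sgraph) (H : subgraph T) : Prop :=
  [/\ is_tree H,
      (exists2 H' : sgraph, is_tree H' & isomorphic H (corona H')),
      ~ is_whole H &
      (forall x : T, x \notin sub_vset H -> nbr x :&: sub_supports H = set0)].

(* Main.v *)
(* The key point is that a minimum FD-set is 1-fair.  Counting the edges between
   D and its complement, a k-fair set with k >= 2 has more than n/2 vertices,
   whereas every tree with n >= 2 vertices has a 1-fair dominating set with at
   most n/2 vertices.  The latter is proved by building the tree from single
   vertices, repeatedly joining two rooted trees by an edge between their roots,
   and tracking how cheaply a set can be chosen with the root inside, outside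
   and dominated, or outside and still undominated.

   A 1-fair set whose complement is independent contains all vertices but some
   leaves, hence (i) => (ii).  For a minimum D with adjacent vertices outside D,
   a component of the complement of D together with the private neighbors in D
   of its vertices is a corona; if that is all of T, then the complement of D is
   also a minimum FD-set and contradicts (ii).  Conversely, given a special
   corona-subtree H, the complement of S_H and of the leaves of T outside H is
   1-fair; as some leaf of H is not a leaf of T, it has less than n - l
   vertices. *)
Require Import Defs.
From mathcomp Require Import all_boot.
From mathcomp Require Import zify.

Set Implicit Arguments.
Unset Strict Implicit.
Unset Printing Implicit Defensive.

(** * Paths and induced subgraphs *)

Lemma path_closed (S : eqType) (e : rel S) (P : {pred S}) x p :
    (forall u v, u \in P -> e u v -> v \in P) ->
  x \in P -> path e x p -> {subset x :: p <= P}.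
Proof.
move=> clP; elim: p x => [|y p IH] x xP /=.
  by move=> _ z; rewrite inE => /eqP->.
case/andP=> xy yp z; rewrite inE => /predU1P[->//|].
exact: IH (clP _ _ xP xy) yp z.
Qed.

Lemma connect_step (S : finType) (e : rel S) x y :
  connect e x y -> x != y -> exists z, e x z.
Proof.
case/connectP=> [[|z p]] /= => [_ ->|/andP[xz _] _ _]; first by rewrite eqxx.
by exists z.
Qed.

Section Graph.
Variable T : sgraph.
Implicit Types (x y z r c : T) (A B C D W : {set T}).

Definition adj_in B : rel T := fun x y => [&& x \in B, y \in B & adj x y].

Lemma adj_in_sym B : symmetric (adj_in B).
Proof. by move=> x y; rewrite /adj_in adj_sym andbCA. Qed.

Lemma adj_in_sub B : subrel (adj_in B) (@adj T).
Proof. by move=> x y /and3P[]. Qed.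

Lemma adj_in_mem B x y : adj_in B x y -> x \in B.
Proof. by case/and3P. Qed.

Lemma connect_in_sym B : connect_sym (adj_in B).
Proof. exact: sym_connect_sym (@adj_in_sym B). Qed.

Lemma connect_inS B C : B \subset C ->
  subrel (connect (adj_in B)) (connect (adj_in C)).
Proof.
move/subsetP=> sBC; apply: connect_sub => x y /and3P[xB yB xy].
by apply: connect1; rewrite /adj_in !sBC.
Qed.

Lemma connect_in_mem B x y : connect (adj_in B) x y -> x \in B -> y \in B.
Proof.
move=> xy xB; have clB : closed (adj_in B) (mem B).
  by move=> u v /and3P[uB vB _]; rewrite /= uB vB.
by rewrite -(closed_connect clB xy).
Qed.

Lemma path_in B x p : path (@adj T) x p -> {subset x :: p <= B} ->
  path (adj_in B) x p.
Proof.
elim: p x => //= y p IH x /andP[xy yp] sB; rewrite /adj_in xy !sB ?mem_head //=;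
  last by rewrite !inE eqxx orbT.
by apply: IH => // z zp; apply: sB; rewrite inE zp orbT.
Qed.

Definition induced W : subgraph T :=
  Subgraph (@adj_in_sym W) (@adj_in_sub W) (@adj_in_mem W).

Lemma FD_set1 D : {in ~: D, forall x, #|nbr x :&: D| = 1} -> FD_set D.
Proof.
move=> D1; exists 1 => //; apply/andP; split; apply/forall_inP => x /D1 E.
  by rewrite -card_gt0 E.
by rewrite E.
Qed.

(** * Consequences of acyclicity *)

Hypothesis treeT : is_tree T.

(** A simple path from [x] to [y] avoiding [z] would close up through [z] to a cycle. This is the
    main form in which acyclicity is used below. *)
Lemma nbr_inj z x y : adj z x -> adj z y ->
  connect (adj_in [set~ z]) x y -> x = y.
Proof.
case: treeT => _ _ acyc zx zy /connectP[p0 /shortenP[p xp Up _] yE].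
apply/eqP/negPn/negP => xy.
have xz : x \in [set~ z] by rewrite !inE; apply/eqP=> E; rewrite E adj_irr in zx.
have zp : z \notin x :: p.
  have clz u v : u \in [set~ z] -> adj_in [set~ z] u v -> v \in [set~ z].
    by move=> _ /and3P[].
  by apply/negP => /(path_closed clz xz xp); rewrite !inE eqxx.
case: p => [|a p] in xp Up yE zp; first by rewrite yE eqxx in xy.
apply: (acyc [:: z, x, a & p]) => //; apply/andP; split; last first.
  by rewrite cons_uniq Up zp.
rewrite /cycle rcons_path -[last _ _]yE adj_sym zy andbT.
rewrite -[path _ _ _]/(adj z x && path (@adj T) x (a :: p)) zx.
by apply: sub_path xp; apply: adj_in_sub.
Qed.

Lemma connect_tree x y : connect (@adj T) x y.
Proof. by case: treeT. Qed.

Lemma induced_tree W : W != set0 ->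
  {in W &, forall x y, connect (adj_in W) x y} -> is_tree (induced W).
Proof.
case: treeT => _ _ acyc /set0Pn[w wW] conW; split.
- by apply/card_gt0P; exists (exist _ w wW).
- case=> x xW [y yW]; case/connectP: (conW x y xW yW) => p.
  elim: p x xW => [|a p IH] x xW /=.
    by move=> _ yE; move: yW; rewrite yE => yW; rewrite (bool_irrelevance xW yW).
  case/andP=> /and3P[_ aW xa] ap yE.
  apply: connect_trans (IH a aW ap yE); apply: connect1.
  by apply/and3P; split.
- move=> c c2 /andP[cc Uc]; apply: (acyc (map val c)); first by rewrite size_map.
  rewrite /ucycle map_inj_uniq ?Uc ?andbT; last exact: val_inj.
  case: c c2 cc {Uc} => //= a c _; rewrite -map_rcons path_map.
  by apply: sub_path => u v /adj_in_sub.
Qed.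

(** * Building trees by joining rooted trees *)

Inductive rooted : T -> {set T} -> Prop :=
| rooted1 r : rooted r [set r]
| rootedU r c A B of rooted r A & rooted c B & [disjoint A & B] &
    {in A & B, forall x y, adj x y = (x == r) && (y == c)} :
    rooted r (A :|: B).

Lemma rooted_mem r B : rooted r B -> r \in B.
Proof. by elim=> {r B} [r|r c A B _ rA _ _ _ _]; rewrite !inE ?eqxx ?rA. Qed.

(** Induction on the size of [B]: for a neighbor [c] of [r], split off the component [C] of [c] in
    [B] minus [r]. By acyclicity [r c] is the only edge between the two parts. *)
Lemma connected_rooted r B : r \in B ->
  {in B, forall x, connect (adj_in B) r x} -> rooted r B.
Proof.
have [n] := ubnP #|B|; elim: n r B => // n IH r B leB rB conB.
have [B1|] := boolP (B \subset [set r]).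
  suff -> : B = [set r] by left.
  by apply/eqP; rewrite eqEsubset B1 sub1set.
case/subsetPn=> x xB; rewrite inE => xr.
have [c /and3P[_ cB rc]] : exists c, adj_in B r c.
  case/connectP: (conB x xB) => [[|c p]] /=; last by case/andP=> rc _ _; exists c.
  by move=> _ E; rewrite E eqxx in xr.
pose C := [set y | connect (adj_in (B :\ r)) c y].
have cr : c != r by apply/eqP => E; rewrite E adj_irr in rc.
have cBr : c \in B :\ r by rewrite !inE cr.
have sC : C \subset B :\ r.
  by apply/subsetP=> y; rewrite inE => /connect_in_mem; apply.
have rC : r \notin C by apply/negP=> /(subsetP sC); rewrite !inE eqxx.
have cC : c \in C by rewrite inE connect0.
have sCB : C \subset B := subset_trans sC (subsetDl _ _).
have clC y z : y \in C -> z \in B :\ r -> adj y z -> z \in C.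
  rewrite [y \in C]inE [z \in C]inE => cy zB yz; apply: (connect_trans cy).
  by apply: connect1; rewrite /adj_in yz zB (connect_in_mem cy cBr).
have -> : B = (B :\: C) :|: C
  by rewrite setDE setUIl setUC (setUidPr _) // setUC setUCr setIT.
apply: (@rootedU r c).
- apply: IH.
  + rewrite -ltnS; apply: leq_trans leB; rewrite ltnS; apply: proper_card.
    rewrite properE subsetDl; apply/subsetPn; exists c => //.
    by rewrite inE cC.
  + by rewrite inE rC.
  + move=> y; rewrite inE => /andP[yC yB].
    case/connectP: (conB y yB) => p0 /shortenP[p rp Up _] yE.
    apply/connectP; exists p => //; apply: path_in.
      exact: sub_path (@adj_in_sub _) _ _ rp.
    have sB : {subset r :: p <= B}.
      by apply: path_closed rB rp => u v _ /and3P[].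
    (* A simple path from [r] that meets [C] at [z] does not return to [r], so its rest would carry
       [y] into [C]. *)
    move=> z zp; rewrite inE sB // andbT.
    apply/negP=> zC; case/negP: yC.
    have {}zp : z \in p by case/predU1P: zp zC rC => // -> ->.
    case/splitPr: p / zp => p1 p2 in rp Up yE sB *.
    rewrite inE; move: (zC); rewrite inE => /connect_trans; apply.
    apply/connectP; exists p2; last by rewrite yE last_cat.
    apply: path_in => [|u up].
      move: rp; rewrite cat_path /= => /and3P[_ _].
      by apply: sub_path; apply: adj_in_sub.
    rewrite !inE sB ?andbT ?inE ?mem_cat ?up ?orbT //.
    move: Up; rewrite /= mem_cat negb_or -andbA => /and3P[_ rp2 _].
    by apply: contraNneq rp2 => <-.
- apply: IH => //.
  + rewrite -ltnS; apply: leq_trans leB; rewrite ltnS; apply: proper_card.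
    rewrite properE sCB; apply/subsetPn; by exists r.
  + move=> y; rewrite inE => /connectP[p cp yE].
    apply/connectP; exists p => //; apply: path_in.
      exact: sub_path (@adj_in_sub _) _ _ cp.
    by apply: path_closed cC cp => u v uC /and3P[_ vB]; apply: clC.
- by rewrite -setI_eq0 setDE -setIA (setIC _ C) setICr setI0.
- move=> y z; rewrite inE => /andP[yC yB] zC.
  apply/idP/andP => [yz|[/eqP-> /eqP-> //]].
  have yr : y = r.
    apply/eqP/negPn/negP=> yr; case/negP: yC.
    by apply: clC zC _ _; rewrite ?inE ?yr // adj_sym.
  subst y; rewrite eqxx; split=> //; apply/eqP/esym/(nbr_inj rc yz).
  move: zC; rewrite inE; apply: connect_inS.
  by apply/subsetP=> u; rewrite !inE => /andP[].
Qed.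

Lemma rootedT r : rooted r [set: T].
Proof.
apply: connected_rooted => // x _; apply: connect_sub (connect_tree r x) => u v uv.
by apply: connect1; rewrite /adj_in !inE.
Qed.

(** * Counting the edges between a set and its complement *)

Lemma card_nbr_join A B D r c x :
    {in A & B, forall x y, adj x y = (x == r) && (y == c)} ->
  x \in A -> D \subset B -> #|nbr x :&: D| = (x == r) && (c \in D).
Proof.
move=> AB xA /subsetP sDB.
have [/andP[/eqP xr cD]|] := boolP (_ && _).
  apply/eqP/cards1P; exists c; apply/setP => y; rewrite !inE.
  have [yD|yD] := boolP (y \in D); first by rewrite AB ?sDB // xr eqxx andbT.
  by rewrite andbF; apply/esym; apply: contraNF yD => /eqP->.
rewrite negb_and => nxc; apply/eqP; rewrite cards_eq0 -subset0.
apply/subsetP => y; rewrite !inE => /andP[xy yD].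
move: xy nxc; rewrite AB ?sDB // => /andP[-> /eqP yc].
by rewrite -yc yD.
Qed.

Lemma card_nbrU A B D1 D2 x : [disjoint A & B] -> D1 \subset A -> D2 \subset B ->
  #|nbr x :&: (D1 :|: D2)| = #|nbr x :&: D1| + #|nbr x :&: D2|.
Proof.
move=> dAB sA sB; rewrite setIUr cardsU.
suff -> : nbr x :&: D1 :&: (nbr x :&: D2) = set0 by rewrite cards0 subn0.
apply/eqP; rewrite -subset0 -(disjoint_setI0 dAB) setISS //.
  exact: subset_trans (subsetIr _ _) sA.
exact: subset_trans (subsetIr _ _) sB.
Qed.

Lemma join_sym A B r c :
    {in A & B, forall x y, adj x y = (x == r) && (y == c)} ->
  {in B & A, forall x y, adj x y = (x == c) && (y == r)}.
Proof. by move=> AB x y xB yA; rewrite adj_sym AB // andbC. Qed.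

Lemma sum_nbr_join A B D r c : r \in A -> [disjoint A & B] ->
    {in A & B, forall x y, adj x y = (x == r) && (y == c)} ->
  \sum_(x in A :\: D) #|nbr x :&: ((A :|: B) :&: D)| <=
  \sum_(x in A :\: D) #|nbr x :&: (A :&: D)| + (r \notin D) && (c \in D).
Proof.
move=> rA dAB AB.
rewrite (eq_bigr (fun x => #|nbr x :&: (A :&: D)| + (x == r) && (c \in B :&: D))).
  rewrite big_split leq_add2l; have [rD|rD] := boolP (r \in D).
    rewrite big1 // => x; rewrite inE => /andP[xD _].
    by case: eqP xD => // ->; rewrite rD.
  rewrite (bigD1 r) /= ?inE ?rD // eqxx big1 => [|x /andP[_ /negPf->]//].
  by rewrite addn0; case: (c \in D); rewrite ?andbF ?leq_b1.
move=> x; rewrite inE => /andP[_ xA].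
by rewrite setIUl (card_nbrU _ dAB) ?subsetIl // (card_nbr_join AB xA (subsetIl B D)).
Qed.

(** The sum counts the edges of [B] between [D] and its complement. Each join adds a single edge,
    counted from at most one of its ends. *)
Lemma sum_nbr_lt r B D : rooted r B ->
  \sum_(x in B :\: D) #|nbr x :&: (B :&: D)| < #|B|.
Proof.
elim=> {r B} [r|r c A B /rooted_mem rA IHA /rooted_mem cB IHB dAB AB].
  rewrite cards1 ltnS leqn0 sum_nat_eq0; apply/forall_inP => x.
  rewrite !inE => /andP[xD /eqP xr]; rewrite cards_eq0 -subset0.
  apply/subsetP => y; rewrite !inE => /and3P[xy /eqP yr _].
  by rewrite xr yr adj_irr in xy.
have dD : [disjoint A :\: D & B :\: D].
  by apply: disjointWl (subsetDl _ _) (disjointWr (subsetDl _ _) dAB).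
have -> : \sum_(x in (A :|: B) :\: D) #|nbr x :&: ((A :|: B) :&: D)| =
    \sum_(x in A :\: D) #|nbr x :&: ((A :|: B) :&: D)| +
    \sum_(x in B :\: D) #|nbr x :&: ((A :|: B) :&: D)|.
  by rewrite -bigU //; apply: eq_bigl => x; rewrite !inE -andb_orr.
have -> : #|A :|: B| = #|A| + #|B|.
  by apply/eqP; rewrite (leq_card_setU A B).
have HA := sum_nbr_join D rA dAB AB.
have HB := sum_nbr_join D cB (etrans (disjoint_sym _ _) dAB) (join_sym AB).
rewrite setUC in HB; move: HA HB IHA IHB.
by case: (r \in D); case: (c \in D) => /=; lia.
Qed.

(** * Small 1-fair dominating sets by recursion on rooted trees *)

(* [b] tells whether the root is in [D]; if it is not, it has [i] neighbors in
   [D], so that [i = 0] leaves it to be dominated from outside [B]. *)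
Definition semiperfect r B i b D :=
  [/\ D \subset B, (r \in D) = b &
      {in B :\: D, forall x, #|nbr x :&: D| = if x == r then i else 1}].

Lemma semiperfect_in r B i j D :
  semiperfect r B i true D -> semiperfect r B j true D.
Proof.
case=> sD rD D1; split=> // x xBD; rewrite D1 //.
by case: eqP xBD => // ->; rewrite inE rD.
Qed.

(** After the join [c] is no longer a root, so it must lie in the set or have exactly one neighbor
    there, possibly [r]. The root [r] gains a neighbor in the set when [b2] holds. *)
Lemma semiperfectU r c A B i1 (b1 : bool) D1 i2 (b2 : bool) D2 :
    r \in A -> c \in B -> [disjoint A & B] ->
    {in A & B, forall x y, adj x y = (x == r) && (y == c)} ->
    b2 || (i2 + b1 == 1) ->
    semiperfect r A i1 b1 D1 -> semiperfect c B i2 b2 D2 ->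
  semiperfect r (A :|: B) (i1 + b2) b1 (D1 :|: D2).
Proof.
move=> rA cB dAB AB b2i [sD1 rD1 p1] [sD2 cD2 p2].
have rB : r \in B = false by apply: disjointFr rA.
split; first exact: setUSS.
  by rewrite inE rD1 [r \in D2](contraFF (subsetP sD2 r)) ?orbF.
move=> x; rewrite !inE negb_or -andbA => /and3P[xD1 xD2].
rewrite (card_nbrU _ dAB sD1 sD2) => /orP[xA|xB].
  rewrite p1 ?inE ?xD1 // (card_nbr_join AB) // cD2.
  by case: (x == r); rewrite ?addn0.
rewrite p2 ?inE ?xD2 // (card_nbr_join (join_sym AB)) // rD1.
have -> : (x == r) = false by apply: contraFF rB => /eqP<-.
case: eqP => [xc|//].
by move: b2i xD2; rewrite xc cD2; case: (b2) => //= /eqP; rewrite addnC.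
Qed.

(* [2 #|D| <= #|B| + 1 - e], the sharpest bound valid for one-vertex trees being
   [e = 0] with the root inside and [e = 2] with the root undominated. *)
Definition cost r B i b e :=
  exists2 D, semiperfect r B i b D & (#|D|).*2 + e <= #|B|.+1.

(** Adding the two bounds leaves [|A| + |B| + 2] on the right, one more than allowed; hence the
    strict inequality on [e]. *)
Lemma costU r c A B i1 (b1 : bool) e1 i2 (b2 : bool) e2 e :
    r \in A -> c \in B -> [disjoint A & B] ->
    {in A & B, forall x y, adj x y = (x == r) && (y == c)} ->
    cost r A i1 b1 e1 -> cost c B i2 b2 e2 ->
    b2 || (i2 + b1 == 1) -> e < e1 + e2 ->
  cost r (A :|: B) (i1 + b2) b1 e.
Proof.
move=> rA cB dAB AB [D1 p1 c1] [D2 p2 c2] b2i ee.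
exists (D1 :|: D2); first exact: semiperfectU b2i p1 p2.
have -> : #|A :|: B| = #|A| + #|B| by apply/eqP; rewrite (leq_card_setU A B).
by have := cardsUI D1 D2; lia.
Qed.

(* The alternatives are found by closing the costs of a single vertex under
   [costU]; each of them makes the first or the second state cost at most half
   of the vertices. *)
Definition cheap r B :=
  [\/ cost r B 1 true 2, cost r B 1 true 1 /\ cost r B 1 false 1,
      cost r B 1 true 1 /\ cost r B 0 false 3 |
      [/\ cost r B 1 true 0, cost r B 1 false 2 & cost r B 0 false 2]].

Lemma cheap_rooted r B : rooted r B -> 1 < #|B| -> cheap r B.
Proof.
move=> rB B1.
(* One-vertex trees satisfy no alternative of [cheap], so the induction carries them as a separate
   case. *)
suff: cheap r B \/ [/\ #|B| = 1, cost r B 1 true 0 & cost r B 0 false 2].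
  by case=> // -[E]; rewrite E in B1.
elim: rB {B1} => {r B} [r|r c A B /rooted_mem rA IHA /rooted_mem cB IHB dAB AB].
  right; split; first exact: cards1.
    exists [set r]; last by rewrite cards1.
    by split; rewrite ?inE ?eqxx // => x; rewrite setDv inE.
  exists set0; last by rewrite cards0 cards1.
  by split; rewrite ?sub0set ?inE // => x; rewrite setD0 inE setI0 cards0 => ->.
left; have U i1 b1 e1 i2 b2 e2 e := @costU r c A B i1 b1 e1 i2 b2 e2 e rA cB dAB AB.
(* The two letters are the states of [A] and [B]: [a] for the root inside, [b] for outside and
   dominated, [c] for outside and undominated. *)
have Uaa e1 e2 e : cost r A 1 true e1 -> cost c B 1 true e2 ->
    e < e1 + e2 -> cost r (A :|: B) 1 true e.
  move=> H1 H2 ee; case: (U _ _ _ _ _ _ _ H1 H2 isT ee) => // D.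
  by move/semiperfect_in; exists D.
have Uac e1 e2 e : cost r A 1 true e1 -> cost c B 0 false e2 ->
    e < e1 + e2 -> cost r (A :|: B) 1 true e.
  move=> H1 H2 ee; case: (U _ _ _ _ _ _ _ H1 H2 isT ee) => // D.
  by move/semiperfect_in; exists D.
have Ubb e1 e2 e : cost r A 1 false e1 -> cost c B 1 false e2 ->
    e < e1 + e2 -> cost r (A :|: B) 1 false e.
  by move=> H1 H2 ee; exact: U H1 H2 isT ee.
have Uca e1 e2 e : cost r A 0 false e1 -> cost c B 1 true e2 ->
    e < e1 + e2 -> cost r (A :|: B) 1 false e.
  by move=> H1 H2 ee; exact: U H1 H2 isT ee.
have Ucb e1 e2 e : cost r A 0 false e1 -> cost c B 1 false e2 ->
    e < e1 + e2 -> cost r (A :|: B) 0 false e.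
  by move=> H1 H2 ee; exact: U H1 H2 isT ee.

case: IHA => [[a|[a b]|[a c1]|[a b c1]]|[_ a c1]];
case: IHB => [[a'|[a' b']|[a' c']|[a' b' c']]|[_ a' c']].
(* Each of the 25 cases is settled by the first alternative whose bounds the joins deliver. *)
all: try by apply: Or41; first [by apply: (Uaa _ _ _ a a')|by apply: (Uac _ _ _ a c')].
all: try by apply: Or42; split; first
  [by apply: (Uaa _ _ _ a a')|by apply: (Uac _ _ _ a c')
  |by apply: (Ubb _ _ _ b b')|by apply: (Uca _ _ _ c1 a')].
all: try by apply: Or43; split; first
  [by apply: (Uaa _ _ _ a a')|by apply: (Uac _ _ _ a c')|by apply: (Ucb _ _ _ c1 b')].
all: apply: Or44; split; first
  [by apply: (Uaa _ _ _ a a')|by apply: (Uac _ _ _ a c')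
  |by apply: (Ubb _ _ _ b b')|by apply: (Uca _ _ _ c1 a')
  |by apply: (Ucb _ _ _ c1 b')].
Qed.

(** * Minimum FD-sets are 1-fair *)

Lemma FD_half : 1 < #|T| -> exists2 D : {set T}, FD_set D & (#|D|).*2 <= #|T|.
Proof.
move=> T1; have [r _] : exists r : T, r \in T by apply/card_gt0P/ltnW.
(* At [i = 1] the set is 1-fair in the whole tree, and [e > 0] absorbs the extra 1 in the bound of
   [cost]. *)
have FD b e : 0 < e -> cost r [set: T] 1 b e ->
    exists2 D : {set T}, FD_set D & (#|D|).*2 <= #|T|.
  move=> e0 [D [_ _ D1] cD]; exists D; last by rewrite cardsT in cD; lia.
  by apply: FD_set1 => x xD; rewrite D1 ?if_same // setTD.
have := cheap_rooted (rootedT r); rewrite cardsT => /(_ T1).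
by case=> [|[]|[]|[]] *;
  [apply: (FD true 2)|apply: (FD true 1)|apply: (FD true 1)|apply: (FD false 2)].
Qed.

(** Each of the [n - |D|] outside vertices sends [k >= 2] edges to [D], with fewer than [n] in all;
    hence [2 (n - |D|) < n]. *)
Lemma fair_half k D : 1 < k -> fair_dominating k D -> #|T| < (#|D|).*2.
Proof.
move=> k1 /andP[_ /forall_inP kD].
have [r _] : exists r : T, r \in T by apply/card_gt0P; case: treeT.
have := sum_nbr_lt D (rootedT r); rewrite cardsT setTI setTD.
rewrite (eq_bigr (fun=> k)) => [|x xD]; last exact/eqP/kD.
by rewrite sum_nat_const; have := cardsC D; nia.
Qed.

Lemma min_FD1 D : 1 < #|T| -> FD_set D -> #|D| = fd T ->
  {in ~: D, forall x, #|nbr x :&: D| = 1}.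
Proof.
move=> T1 [k k0 kD] Dm x xD.
have [_ fdle] := fdP T; have [D' FD' cD'] := FD_half T1.
have k1 : k <= 1.
  rewrite leqNgt; apply/negP => k2.
  by have := fair_half k2 kD; have := fdle _ FD'; lia.
by case/andP: kD => _ /forall_inP/(_ x xD)/eqP->; apply/eqP; rewrite eqn_leq k1.
Qed.

(** * (i) implies (ii) *)

(** Two adjacent leaves form a set closed under adjacency, which in a connected graph is
    everything. *)
Lemma adj_leaves u v : 2 < #|T| -> u \in leaves T -> v \in leaves T -> ~~ adj u v.
Proof.
rewrite !inE => T3 /cards1P[u' uE] /cards1P[v' vE]; apply/negP => uv.
have nu x : adj u x = (x == v).
  have: v \in nbr u by rewrite inE.
  by rewrite -[adj u x](in_set (adj u)) -/(nbr u) uE !inE => /eqP->.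
have nv x : adj v x = (x == u).
  have: u \in nbr v by rewrite inE adj_sym.
  by rewrite -[adj v x](in_set (adj v)) -/(nbr v) vE !inE => /eqP->.
have cl : closed (@adj T) (mem [set u; v]).
  apply: intro_closed => [|x y xy]; first exact: sym_connect_sym (@adj_sym T).
  by rewrite !inE => /orP[]/eqP xE; move: xy; rewrite xE ?nu ?nv => ->; rewrite ?orbT.
have: #|T| <= #|[set u; v]|.
  rewrite -cardsT; apply/subset_leq_card/subsetP => x _.
  by rewrite -(closed_connect cl (connect_tree u x)) !inE eqxx.
by move=> /(leq_trans T3); rewrite cards2; case: (_ != _).
Qed.

Lemma fd_lt_adj D : 2 < #|T| -> fd T < #|T| - #|leaves T| ->
  FD_set D -> #|D| = fd T -> exists u v : T, [/\ u \notin D, v \notin D & adj u v].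
Proof.
move=> T3 lt FD Dm; have D1 := min_FD1 (ltnW T3) FD Dm.
have [/existsP[u /existsP[v /and3P[uD vD uv]]]|/negP nex] :=
    boolP [exists u, exists v, [&& u \notin D, v \notin D & adj u v]].
  by exists u, v.
(* With an independent complement, an outside vertex has all its neighbors in [D], hence exactly
   one. *)
suff /subset_leq_card : ~: D \subset leaves T.
  have := cardsC D; lia.
apply/subsetP => x xD; rewrite inE -(D1 x xD); apply/eqP; congr #|pred_of_set _|.
apply/esym/setIidPl/subsetP => y; rewrite inE => xy; apply/negPn/negP => yD.
by apply: nex; apply/existsP; exists x; apply/existsP; exists y; rewrite -in_setC xD yD.
Qed.

(** * (ii) implies (iii) *)

Lemma connect_comp B x y : connect (adj_in B) x y -> x \in B ->
  connect (adj_in [set z | connect (adj_in B) x z]) x y.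
Proof.
case/connectP=> p xp yE xB; apply/connectP; exists p => //; apply: path_in.
  by apply: sub_path xp; apply: adj_in_sub.
apply: path_closed xp; last by rewrite inE connect0.
by move=> a b; rewrite !inE => xa /connect1; apply: connect_trans.
Qed.

Lemma special_corona_of_fair D u v :
    (forall D, FD_set D -> #|D| = fd T ->
       exists u v : T, [/\ u \notin D, v \notin D & adj u v]) ->
    #|D| = fd T -> {in ~: D, forall x, #|nbr x :&: D| = 1} ->
    u \notin D -> v \notin D -> adj u v ->
  exists H : subgraph T, special_corona_subtree H.
Proof.
move=> minD Dm D1 uD vD uv.
(* The private neighbor of [x] in [D]; the default value does not occur for [x] outside [D]. *)
pose p x := odflt x [pick y in nbr x :&: D].
pose C := [set x | connect (adj_in (~: D)) u x].
have uD' : u \in ~: D by rewrite inE.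
have uC : u \in C by rewrite inE connect0.
have CD x : x \in C -> x \in ~: D.
  by rewrite inE => /connect_in_mem; apply.
have vC : v \in C by rewrite inE connect1 // /adj_in uv !inE uD vD.
have clC x y : x \in C -> y \notin D -> adj x y -> y \in C.
  move=> xC yD xy; move: (xC); rewrite !inE => /connect_trans; apply.
  by apply: connect1; rewrite /adj_in xy CD // inE yD.
have pP x : x \in C ->
    [/\ p x \in D, adj x (p x) & forall y, adj x y -> y \in D -> y = p x].
  move/CD/D1/eqP/cards1P=> [d dE].
  have pd : p x = d.
    rewrite /p; case: pickP => [y|/(_ d)] /=; first by rewrite dE inE => /eqP.
    by rewrite dE !inE eqxx.
  have : d \in nbr x :&: D by rewrite dE inE.
  rewrite pd !inE => /andP[xd dD]; split=> // y xy yD.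
  by apply/set1P; rewrite -dE !inE xy.
have conCD x y : x \in C -> y \in C -> connect (adj_in (~: D)) x y.
  by rewrite !inE connect_in_sym; apply: connect_trans.
have conC x y : x \in C -> y \in C -> connect (adj_in C) x y.
  have conu z : z \in C -> connect (adj_in C) u z.
    by move=> zC; apply: (@connect_comp (~: D)) => //; apply: conCD.
  by move=> xC yC; apply: connect_trans (conu y yC); rewrite connect_in_sym conu.
have avoid z : z \in D -> ~: D \subset [set~ z].
  by move=> zD; rewrite setCS sub1set.
(* Two vertices of [C] are joined outside [D], so a common private neighbor would close a cycle. *)
have pI : {in C &, injective p}.
  move=> x y xC yC pE; have [pxD xp _] := pP x xC; have [_ yp _] := pP y yC.
  apply: (@nbr_inj (p x)); rewrite 1?adj_sym // ?pE //.
  by apply: connect_inS (conCD x y xC yC); apply: avoid; rewrite -pE.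
have padj x y : x \in C -> y \in C -> adj x (p y) -> x = y.
  move=> xC yC xpy; apply: pI => //; have [_ _ xu] := pP x xC.
  by have [pyD _ _] := pP y yC; apply/esym/xu.
(* An edge between [p x] and [p y] would close a cycle through [C]. *)
have pN x y : x \in C -> y \in C -> ~~ adj (p x) (p y).
  move=> xC yC; apply/negP => pxy.
  have [pxD xp _] := pP x xC; have [pyD yp _] := pP y yC.
  suff xE : x = p y by move: (CD x xC); rewrite inE xE pyD.
  have px : adj (p x) x by rewrite adj_sym.
  apply: (nbr_inj px pxy); apply: (@connect_trans _ _ y).
    by apply: connect_inS (conCD x y xC yC); apply: avoid.
  apply: connect1; rewrite /adj_in yp !inE andbT; apply/andP; split.
    by apply: contraTneq pxD => <-; move: (CD y yC); rewrite inE.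
  by apply: contraTneq pxy => ->; rewrite adj_irr.
pose W := C :|: p @: C.
have CW x : x \in C -> x \in W by move=> xC; rewrite inE xC.
have pW x : x \in C -> p x \in W by move=> xC; rewrite inE imset_f ?orbT.
have sCW : C \subset W by apply/subsetP.
have conW x : x \in W -> connect (adj_in W) u x.
  rewrite inE => /orP[xC|/imsetP[y yC ->]]; first exact: connect_inS (conC _ _ uC xC).
  apply: connect_trans (connect_inS sCW (conC _ _ uC yC)) _.
  by apply: connect1; rewrite /adj_in CW ?pW //; case: (pP y yC).
have treeC : is_tree (induced C).
  by apply: induced_tree; [apply/set0Pn; exists u|move=> x y; apply: conC].
have treeW : is_tree (induced W).
  apply: induced_tree; first by apply/set0Pn; exists u; apply: CW.
  by move=> x y xW yW; apply: connect_trans (conW y yW); rewrite connect_in_sym conW.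
have supC x : x \in sub_supports (induced W) -> x \in C.
  case/imsetP=> [[s sW]]; rewrite inE => /existsP[[t tW] /andP[tl st]] xE.
  rewrite {}xE /=; move: (sW); rewrite inE => /orP[//|/imsetP[z zC sE]].
  case/and3P: st => /= _ _ st.
  (* Inside [W], the only possible neighbor of [p z] is [z]. *)
  have tz : t = z.
    move: (tW); rewrite inE => /orP[tC|/imsetP[y yC tE]].
      by apply: padj; rewrite // -sE adj_sym.
    by move: (pN z y zC yC); rewrite -sE -tE st.
  (* Thanks to [v], [C] has at least two vertices, so [z] also has a neighbor in [C], one too many
     for a leaf. *)
  have [w /and3P[_ wC zw]] : exists w, adj_in C z w.
    have [zu|zu] := eqVneq z u; first by exists v; rewrite zu /adj_in uC vC.
    exact: connect_step (conC z u zC uC) zu.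
  move: tl; rewrite inE => /cards1P[q qE].
  have sq : exist _ s sW = q :> induced W.
    by apply/set1P; rewrite -qE inE /= /sub_rel /= /adj_in sW tW adj_sym.
  have wq : exist _ w (CW w wC) = q :> induced W.
    by apply/set1P; rewrite -qE inE /= /sub_rel /= /adj_in tW CW // tz.
  have /(congr1 val) /= ws := etrans wq (esym sq).
  by rewrite -ws.
exists (induced W); split=> //.
- exists (induced C) => //.
  pose g (a : corona (induced C)) : induced W :=
    match a with
    | inl a => exist _ (val a) (CW _ (valP a))
    | inr a => exist _ (p (val a)) (pW _ (valP a))
    end.
  have gI : injective g.
    have pC a b : a \in C -> b \in C -> a <> p b.
      by move=> aC bC aE; move: (CD a aC); rewrite inE aE; case: (pP b bC) => ->.
    move=> [[a aC]|[a aC]] [[b bC]|[b bC]] /(congr1 val) /= abE.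
    - by congr inl; apply: val_inj.
    - by case: (pC a b).
    - by case: (pC b a).
    - by congr inr; apply: val_inj; apply: pI.
  have gadj a b : adj (g a) (g b) = adj a b.
    case: a b => [[a aC]|[a aC]] [[b bC]|[b bC]];
      rewrite /= /sub_rel /= /adj_in ?pW ?CW // ?aC ?bC //=.
    - apply/idP/eqP => [/(padj _ _ aC bC) E|[->]]; last by case: (pP b bC).
      exact: val_inj.
    - rewrite adj_sym; apply/idP/eqP => [/(padj _ _ bC aC) E|[->]];
        last by case: (pP b bC).
      exact/esym/val_inj.
    - exact/negbTE/pN.
  have gB : bijective g.
    apply: inj_card_bij => //; rewrite card_sum !card_sig.
    by apply: leq_trans (leq_card_setU _ _) _; rewrite leq_add2l leq_imset_card.
  case: gB => f gK fK; exists f; first by exists g.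
  by move=> x y; rewrite -gadj !fK.
(* If [W] is everything, [p] matches [C] with [D], so [C] is an FD-set of the same size. Its
   complement [D] is independent, against [minD]. *)
- case=> /= WT _.
  have inW x : x \in W by rewrite WT.
  have DE x : x \in D -> exists2 y, y \in C & x = p y.
    move=> xD; move: (inW x); rewrite inE => /orP[/CD|/imsetP[y yC ->]].
      by rewrite inE xD.
    by exists y.
  have CE : ~: D = C.
    apply/setP => x; apply/idP/idP => [xD|/CD //].
    move: (inW x); rewrite inE => /orP[//|/imsetP[y yC xE]].
    by move: xD; rewrite inE xE; case: (pP y yC) => ->.
  have [||a [b []]] := minD (~: D).
  + apply: FD_set1 => x; rewrite setCK => /DE[y yC ->].
    apply/eqP/cards1P; exists y; apply/setP => z.
    rewrite CE in_setI in_set1 [z \in nbr _]inE.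
    have [_ yp _] := pP y yC.
    apply/andP/eqP => [[pz zC]|->]; last by rewrite adj_sym.
    by apply: padj; rewrite // adj_sym.
  + rewrite -Dm CE -(card_in_imset pI); apply: eq_card => x.
    apply/imsetP/idP => [[y yC ->]|/DE //]; by case: (pP y yC).
  + rewrite !inE !negbK => /DE[y yC ->] /DE[z zC ->].
    exact/negP/pN.
(* A neighbor of [y] in [C] is [p y] if it lies in [D], and belongs to the component [C]
   otherwise. *)
- move=> x /= xW; apply/eqP; rewrite -subset0; apply/subsetP => y.
  rewrite inE [y \in nbr x]inE => /andP[xy /supC yC]; rewrite adj_sym in xy.
  case/negP: xW; have [xD|xD] := boolP (x \in D); last exact/CW/(clC y).
  by have [_ _ yE] := pP y yC; rewrite (yE x xy xD) pW.
Qed.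

(** * (iii) implies (i) *)

(** The first step [z] of a simple path from [x] to [y] in [H] is a neighbor of [x] joined to [y]
    avoiding [x], so [z = y]. *)
Lemma subtree_induced (H : subgraph T) x y : is_tree H ->
  x \in sub_vset H -> y \in sub_vset H -> adj x y -> sub_adj H x y.
Proof.
case=> _ conH _ xH yH xy.
have /connectP[p0 /shortenP[p xp Up _] yE] := conH (exist _ x xH) (exist _ y yH).
case: p => [|z q] in xp Up yE.
  by case: yE xy => ->; rewrite adj_irr.
move: xp => /= /andP[xz zq]; have zE := sub_adj_sub xz.
suff <- : val z = y by [].
apply: (nbr_inj zE xy); apply/connectP; exists (map val q).
  apply: path_in.
    by rewrite path_map; apply: sub_path zq => a b; apply: sub_adj_sub.
  move=> u; rewrite -[_ :: _]/(map val (z :: q)) => /mapP[t tq ->]; rewrite !inE.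
  case/andP: Up => + _; apply: contraNneq => tx.
  by have <- : t = exist _ x xH by apply: val_inj.
by rewrite last_map; apply: (congr1 val yE).
Qed.

Lemma fd_lt_of_special_corona (H : subgraph T) : 2 < #|T| ->
  special_corona_subtree H -> fd T < #|T| - #|leaves T|.
Proof.
move=> T3 [treeH [H' treeH' [f [g fK gK] fadj]] nwhole spec].
pose W := sub_vset H.
(* The copies in [T] of a vertex of [H'] and of the leaf attached to it. *)
pose s (x : H') := val (g (inl x)); pose l (x : H') := val (g (inr x)).
have gadj a b : sub_adj H (val (g a)) (val (g b)) = corona_adj a b.
  by have := fadj (g a) (g b); rewrite !gK.
have gI : injective (fun a => val (g a)).
  by move=> a b /val_inj/(can_inj gK).
have sW (x : H') : s x \in W := valP _.
have lW (x : H') : l x \in W := valP _.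
have WP y : y \in W -> exists a, y = val (g a).
  by move=> yW; exists (f (exist _ y yW)); rewrite fK.
have adjW x y : x \in W -> y \in W -> adj x y = sub_adj H x y.
  by move=> xW yW; apply/idP/idP; [apply: subtree_induced|apply: sub_adj_sub].
have supP (a b : corona H') :
      corona_adj a b -> (forall d, corona_adj b d -> d = a) ->
    val (g a) \in sub_supports H.
  move=> ab bU; apply/imsetP; exists (g a) => //; rewrite inE.
  apply/existsP; exists (g b); apply/andP; split;
    last by rewrite -[adj _ _]/(sub_adj H _ _) gadj.
  rewrite inE; apply/cards1P; exists (g a); apply/setP => t; rewrite !inE.
  rewrite -[t]fK -[adj _ _]/(sub_adj H _ _) gadj (can_eq gK).
  apply/idP/eqP => [/bU //|->]; by rewrite corona_sym.
have sup (x : H') : s x \in sub_supports H.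
  by apply: (supP _ (inr x)) => //= -[y /eqP->|].
have sN (x : H') y : y \notin W -> ~~ adj (s x) y.
  move=> yW; apply/negP => xy; have := spec y yW => /setP/(_ (s x)).
  by rewrite in_setI sup in_set0 andbT [_ \in nbr y]inE adj_sym xy.
have WnT : W != [set: T].
  apply/eqP => WT; case: nwhole; split=> // x y.
  by rewrite -adjW // WT.
have adj_sl (x : H') : adj (s x) (l x) by rewrite adjW // gadj /=.
have lNs (x y : H') : l x <> s y by move/gI.
(* By connectedness some edge leaves [W]; it cannot start at a support [s x], so it starts at some
   [l x0]. *)
have [x0 [y0 [y0W l0]]] : exists (x0 : H') y0, y0 \notin W /\ adj (l x0) y0.
  have /subsetPn[w _ wW] : ~~ ([set: T] \subset W) by rewrite subTset.
  have [/existsP[a /existsP[b /and3P[/WP[[x|x] aE] bW ab]]]|nex] :=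
      boolP [exists a, exists b, [&& a \in W, b \notin W & adj a b]].
  - by case/negP: (sN x b bW); rewrite -[s x]aE.
  - by exists x, b; rewrite -[l x]aE.
  case/negP: wW; have [x _] : exists x : H', x \in H'.
    by apply/card_gt0P; case: treeH'.
  case/connectP: (connect_tree (s x) w) => p sp ->.
  apply: (path_closed _ (sW x) sp); last exact: mem_last.
  move=> a b aW ab; apply: contraNT nex => bW.
  by apply/existsP; exists a; apply/existsP; exists b; rewrite aW bW.
(* Otherwise [s x0] is a leaf of [H], which makes [l x0] a support with the outside neighbor
   [y0]. *)
have [x1 x01] : exists x1 : H', adj x0 x1.
  apply/existsP; apply: contraT; rewrite negb_exists => /forallP nx0.
  have: l x0 \in sub_supports H.
    apply: (supP _ (inl x0)) => //= -[y|y /eqP->//].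
    by rewrite (negPf (nx0 y)).
  move=> lsup; have := spec y0 y0W => /setP/(_ (l x0)).
  by rewrite in_setI lsup in_set0 andbT [_ \in nbr y0]inE adj_sym l0.
have sleaf (x : H') : s x \notin leaves T.
  have [y xy] : exists y : H', adj x y.
    have [->|xx0] := eqVneq x x0; first by exists x1.
    by case: treeH' => _ con _; apply: connect_step (con x x0) xx0.
  rewrite inE; apply/cards1P => -[z zE].
  have lz : l x \in [set z] by rewrite -zE inE.
  have sz : s y \in [set z] by rewrite -zE inE adjW // gadj.
  by move: lz sz; rewrite !inE => /eqP<- /eqP/esym/lNs.
pose S := [set s x | x : H']; pose N := leaves T :\: W.
(* The unique neighbor is [l x] for [s x], and [b] for a leaf [a] outside [W]: [b] is not in [S], as
   [H] is special, nor a leaf, as [n >= 3]. *)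
have D1 : {in ~: ~: (S :|: N), forall x, #|nbr x :&: ~: (S :|: N)| = 1}.
  move=> a; rewrite setCK inE => /orP[/imsetP[x _ ->]|].
    apply/eqP/cards1P; exists (l x); apply/setP => y.
    rewrite !in_setI in_setC in_setU in_set1 [y \in nbr _]inE.
    apply/andP/eqP => [[xy yD]|->].
      have yW : y \in W by apply: contraLR xy; apply: sN.
      case/WP: yW xy yD => [[z|z] ->]; rewrite ?adjW ?gadj ?(valP (g _)) //=.
        by rewrite -/(s z) [s z \in S]imset_f.
      by move=> /eqP->.
    split; first exact: adj_sl.
    by rewrite !inE lW orbF; apply/imsetP=> -[z _ /lNs].
  rewrite inE => /andP[aW al].
  move: (al); rewrite inE => /cards1P[b bE].
  apply/eqP/cards1P; exists b; rewrite bE; apply/setIidPl; rewrite sub1set.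
  have ab : adj a b by rewrite -[adj a b]in_set -/(nbr a) bE inE.
  rewrite in_setC in_setU negb_or; apply/andP; split.
    by apply/imsetP=> -[x _ bs]; case/negP: (sN x a aW); rewrite -bs adj_sym.
  by rewrite inE negb_and; apply/orP; right; apply: contraL ab => bl; apply: adj_leaves.
have [_ /(_ _ (FD_set1 D1)) fdD] := fdP T.
apply: leq_ltn_trans fdD _.
have cS : #|S| = #|H'| by rewrite card_imset // => x y /gI[].
have cSN : #|S :|: N| = #|S| + #|N|.
  apply/eqP; rewrite (leq_card_setU S N) -setI_eq0 -subset0.
  by apply/subsetP => _ /setIP[/imsetP[x _ ->]]; rewrite inE sW.
(* No [s x] is a leaf of [T], nor is [l x0], with its neighbors [s x0] and [y0]. So [S] outnumbers
   the leaves in [W], and [S :|: N] all leaves. *)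
have cL : #|leaves T :&: W| < #|H'|.
  have: leaves T :&: W \subset l @: [set~ x0].
    apply/subsetP => a /setIP[aL /WP[[x|x] aE]].
      by move: aL; rewrite aE (negPf (sleaf x)).
    rewrite aE; apply: imset_f; rewrite !inE; apply/eqP => xx0.
    move: aL; rewrite aE xx0 inE => /cards1P[z zE].
    have sz : s x0 \in [set z] by rewrite -zE inE adj_sym.
    have yz : y0 \in [set z] by rewrite -zE inE.
    by case/negP: y0W; move: sz yz; rewrite !inE => /eqP<- /eqP->.
  move/subset_leq_card/leq_trans/(_ (leq_imset_card _ _)).
  have := cardsC [set x0]; rewrite cards1 => <- /leq_ltn_trans; apply.
  by rewrite add1n.
have := cardsC (S :|: N); have := cardsID W (leaves T); rewrite -/N; lia.
Qed.

End Graph.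

Theorem theorem4 (T : sgraph) (treeT : is_tree T) (n3 : 3 <= #|T|) :
  [<-> fd T < #|T| - #|leaves T|;
       forall D : {set T}, FD_set D -> #|D| = fd T ->
         exists u v : T, [/\ u \notin D, v \notin D & adj u v];
       exists H : subgraph T, special_corona_subtree H].
Proof.
tfae.
- by move=> lt D; apply: fd_lt_adj.
- move=> minD; have [[D FD Dm] _] := fdP T.
  have [u [v [uD vD uv]]] := minD D FD Dm.
  by apply: (special_corona_of_fair treeT minD Dm _ uD vD uv);
    apply: min_FD1 (ltnW n3) FD Dm.
- by case=> H; apply: fd_lt_of_special_corona.
Qed.
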